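(* Let $m$ and $n$ be positive integers. (1) If $\phi_i:\langle\mathbf{DS}_n\rangle\to\langle\mathbf{DS}_n\rangle$ ($i=1,\ldots,m$) is a multiplicative spectrum (resp. trace) preserver on $\langle\mathbf{DS}_n\rangle$, and $\gamma_i:\langle\mathbf{RS}_n\rangle\to R_n$ ($i=1,\ldots,m$) are arbitrary maps, then the maps $\widetilde\phi_i:\langle\mathbf{RS}_n\rangle\to\langle\mathbf{RS}_n\rangle$ ($i=1,\ldots,m$) defined by $$\widetilde\phi_i(A)=\phi_i(A_{\mathbf{DS}})+\gamma_i(A),\qquad A\in\langle\mathbf{RS}_n\rangle,$$ form a multiplicative spectrum (resp. trace) preserver on $\langle\mathbf{RS}_n\rangle$. Moreover, $\widetilde\phi_i$ is an extension of $\phi_i$ from $\langle\mathbf{DS}_n\rangle$ to $\langle\mathbf{RS}_n\rangle$ for $i=1,\ldots,m$ if and only if each $\gamma_i$ sends $\langle\mathbf{DS}_n\rangle$ to $0$. (2) Conversely, if $\widetilde\psi_i:\langle\mathbf{RS}_n\rangle\to\langle\mathbf{RS}_n\rangle$ ($i=1,\ldots,m$) is a multiplicative spectrum (resp. trace) preserver on $\langle\mathbf{RS}_n\rangle$, then the maps $\psi_i:\langle\mathbf{DS}_n\rangle\to\langle\mathbf{DS}_n\rangle$ ($i=1,\ldots,m$) defined by $$\psi_i(A)=\widetilde\psi_i(A)_{\mathbf{DS}},\qquad A\in\langle\mathbf{DS}_n\rangle,$$ form a multiplicative spectrum (resp. trace) preserver on $\langle\mathbf{DS}_n\rangle$. Moreover,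 when $m\ge2$, each $\widetilde\psi_i$ can be written as $$\widetilde\psi_i(A)=\psi_i(A_{\mathbf{DS}})+\gamma_i(A),\qquad A\in\langle\mathbf{RS}_n\rangle,$$ for the map $\gamma_i:\langle\mathbf{RS}_n\rangle\to R_n$ defined by $\gamma_i(A)=\widetilde\psi_i(A)_R$.
   Context: $\mathbf{DS}_n$ (resp. $\mathbf{RS}_n$) is the set of $n\times n$ doubly stochastic (resp. row stochastic) matrices: real, entrywise nonnegative, with all row sums and column sums (resp. all row sums) equal to $1$. $\langle\cdot\rangle$ denotes the real linear span. Let $e=(1,\ldots,1)^t\in\mathbb{R}^n$ and $R_n=\{ev^t: v\in\mathbb{R}^n,\ v^te=0\}$. One has the vector space direct sum $\langle\mathbf{RS}_n\rangle=\langle\mathbf{DS}_n\rangle\oplus R_n$, and for $A\in\langle\mathbf{RS}_n\rangle$ we write $A=A_{\mathbf{DS}}+A_R$ with $A_{\mathbf{DS}}\in\langle\mathbf{DS}_n\rangle$ and $A_R\in R_n$; explicitly, $A_R=er^t$ where $r_i=\frac1n\sum_{k}a_{ki}-\frac1{n^2}\sum_{k,l}a_{kl}$ and $A_{\mathbf{DS}}=A-A_R$. A list of maps $\phi_1,\ldots,\phi_m:\mathcal{S}\to\mathcal{S}$ is a multiplicative spectrum (resp. trace) preserver on $\mathcal{S}$ if $\operatorname{spec}(\phi_1(A_1)\cdots\phi_m(A_m))=\operatorname{spec}(A_1\cdots A_m)$ (resp. $\operatorname{tr}(\phi_1(A_1)\cdots\phi_m(A_m))=\operatorname{tr}(A_1\cdots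 A_m)$) for all $A_1,\ldots,A_m\in\mathcal{S}$. $\operatorname{spec}$ is the spectrum (multiset of complex eigenvalues) counting multiplicities. *)

(* Defs.v *)
From mathcomp Require Import all_boot all_order all_algebra.
From mathcomp Require Import finmap multiset complex.
From mathcomp Require Import ring lra.
From mathcomp Require Import boolp classical_sets functions reals.

Set Implicit Arguments.
Unset Strict Implicit.
Unset Printing Implicit Defensive.

Import Order.TTheory GRing.Theory Num.Theory.

Local Open Scope mset_scope.
Local Open Scope complex_scope.
Local Open Scope classical_set_scope.
Local Open Scope ring_scope.

Section StochasticMatrices.
Variables (R : realType) (n : nat).
Implicit Types A B : 'M[R]_n.

Definition row_stochastic : set 'M[R]_n :=
  [set A | (forall i j, 0 <= A i j) /\ (forall i, \sum_j A i j = 1)].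

Definition doubly_stochastic : set 'M[R]_n :=
  [set A | [/\ forall i j, 0 <= A i j,
               forall i, \sum_j A i j = 1 &
               forall j, \sum_i A i j = 1]].

Definition linear_span (S : set 'M[R]_n) : set 'M[R]_n :=
  [set A | exists (k : nat) (c : 'I_k -> R) (B : 'I_k -> 'M[R]_n),
     (forall i, S (B i)) /\ A = \sum_i c i *: B i].

Definition DSspan : set 'M[R]_n := linear_span doubly_stochastic.
Definition RSspan : set 'M[R]_n := linear_span row_stochastic.

Definition ones : 'cV[R]_n := const_mx 1.

Definition Rspace : set 'M[R]_n :=
  [set A | exists v : 'cV[R]_n, v^T *m ones = 0 /\ A = ones *m v^T].

(* On RSspan, A = DSpart A + Rpart A is the decomposition along the direct sum
   RSspan = DSspan (+) Rspace: see Rpart_Rspace, DSpart_DSspan and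
   DSpart_unique. *)
Definition Rpart A : 'M[R]_n :=
  ones *m (\col_i (n%:R^-1 * (\sum_k A k i)
                   - (n%:R ^+ 2)^-1 * (\sum_k \sum_l A k l)))^T.

Definition DSpart A : 'M[R]_n := A - Rpart A.

(* The roots, with multiplicity, of the characteristic polynomial over R[i]. *)
Definition spec A : {mset R[i]} :=
  seq_mset (sval (closed_field_poly_normal
    (char_poly (map_mx (real_complex R) A)))).

Variant matrix_invariant := Spectrum | Trace.

Definition same_invariant (k : matrix_invariant) A B : Prop :=
  match k with
  | Spectrum => spec A = spec B
  | Trace => \tr A = \tr B
  end.

(* A map S -> S is represented by a total function on matrices that sends S
   to S; its values outside S are never used. The product is taken in
   increasing order of the index. *)
Definition multiplicative_preserver (k : matrix_invariant) (m : nat)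
    (S : set 'M[R]_n) (phi : 'I_m -> 'M[R]_n -> 'M[R]_n) : Prop :=
  (forall i, set_fun S S (phi i)) /\
  (forall A : 'I_m -> 'M[R]_n, (forall i, S (A i)) ->
     same_invariant k (\prod_(i < m) phi i (A i)) (\prod_(i < m) A i)).

Lemma DSspan_RSspan A : DSspan A -> RSspan A.
Proof.
case=> k [c [B [HB ->]]]; exists k, c, B; split => // i.
by have [H1 H2 _] := HB i; split.
Qed.

Lemma Rpart_Rspace A : (0 < n)%N -> Rspace (Rpart A).
Proof.
move=> n0; have nN0 : n%:R != 0 :> R by rewrite pnatr_eq0 -lt0n.
eexists; split; last by [].
apply/matrixP => i j; rewrite !mxE.
under eq_bigr do rewrite !mxE mulr1.
rewrite big_split /= sumrN -mulr_sumr sumr_const card_ord exchange_big /=.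
rewrite -mulr_natr; field.
exact: nN0.
Qed.

Lemma RSspan_row_sum A : RSspan A -> exists c, forall i, \sum_j A i j = c.
Proof.
case=> k [c [B [HB ->]]]; exists (\sum_i c i) => i.
under eq_bigr => j _ do rewrite summxE.
rewrite exchange_big /=; apply: eq_bigr => l _.
under eq_bigr => j _ do rewrite mxE.
by rewrite -mulr_sumr (proj2 (HB l)) mulr1.
Qed.

Lemma DSspan_sums A : DSspan A ->
  exists c, (forall i, \sum_j A i j = c) /\ (forall j, \sum_i A i j = c).
Proof.
case=> k [c [B [HB ->]]]; exists (\sum_i c i); split=> i.
  under eq_bigr => j _ do rewrite summxE.
  rewrite exchange_big /=; apply: eq_bigr => l _.
  under eq_bigr => j _ do rewrite mxE.
  by case: (HB l) => _ H _; rewrite -mulr_sumr H mulr1.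
under eq_bigr => j _ do rewrite summxE.
rewrite exchange_big /=; apply: eq_bigr => l _.
under eq_bigr => j _ do rewrite mxE.
by case: (HB l) => _ _ H; rewrite -mulr_sumr H mulr1.
Qed.

Lemma sums_DSspan A c : (0 < n)%N ->
  (forall i, \sum_j A i j = c) -> (forall j, \sum_i A i j = c) -> DSspan A.
Proof.
move=> n0 Hr Hc; have nN0 : n%:R != 0 :> R by rewrite pnatr_eq0 -lt0n.
pose s := \sum_i \sum_j `|A i j|.
pose t := n%:R * (s + `|c| + 1).
have s0 : 0 <= s by apply: sumr_ge0 => i _; apply: sumr_ge0.
have n1 : 1 <= n%:R :> R by rewrite ler1n.
have ct : 0 < c + t.
  have: s + `|c| + 1 <= t by apply: ler_peMl => //; rewrite !addr_ge0.
  have: - c <= `|c| by rewrite -normrN ler_norm.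
  lra.
pose J : 'M[R]_n := const_mx n%:R^-1.
exists 2%N, (fun i : 'I_2 => if i == ord0 then c + t else - t),
  (fun i : 'I_2 => if i == ord0 then (c + t)^-1 *: (A + t *: J) else J).
split; last first.
  rewrite big_ord_recl big_ord1 /= scalerA divff ?gt_eqF // scale1r scaleNr.
  by rewrite addrK.
have tJ : \sum_(j < n) t * n%:R^-1 = t.
  by rewrite sumr_const card_ord -[LHS]mulr_natr mulfVK.
move=> i; case: ifP => _; split => [a b|a|a].
- rewrite !mxE mulr_ge0 ?invr_ge0 ?ltW // /t [n%:R * _]mulrC mulfK //.
  have : `|A a b| <= s.
    rewrite /s (bigD1 a) //= (bigD1 b) //= -addrA lerDl addr_ge0 ?sumr_ge0 //.
    by move=> *; apply: sumr_ge0.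
  have : - A a b <= `|A a b| by rewrite -normrN ler_norm.
  have := normr_ge0 c; lra.
- under eq_bigr do rewrite !mxE.
  by rewrite -mulr_sumr big_split /= Hr tJ mulVf // gt_eqF.
- under eq_bigr do rewrite !mxE.
  by rewrite -mulr_sumr big_split /= Hc tJ mulVf // gt_eqF.
- by rewrite mxE invr_ge0 ler0n.
- under eq_bigr do rewrite !mxE.
  by rewrite sumr_const card_ord -[LHS]mulr_natr mulVf.
- under eq_bigr do rewrite !mxE.
  by rewrite sumr_const card_ord -[LHS]mulr_natr mulVf.
Qed.

Lemma RpartE A i j :
  Rpart A i j =
  n%:R^-1 * (\sum_k A k j) - (n%:R ^+ 2)^-1 * (\sum_k \sum_l A k l).
Proof. by rewrite !mxE big_ord1 !mxE mul1r. Qed.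

Lemma DSpart_DSspan A : (0 < n)%N -> RSspan A -> DSspan (DSpart A).
Proof.
move=> n0 /RSspan_row_sum[c Hc].
have nN0 : n%:R != 0 :> R by rewrite pnatr_eq0 -lt0n.
have tot : \sum_k \sum_l A k l = n%:R * c.
  by under eq_bigr do rewrite Hc; rewrite sumr_const card_ord mulr_natl.
have [v [v0 Rv]] := Rpart_Rspace A n0.
apply: (@sums_DSspan _ c n0) => i.
  under eq_bigr => j _ do rewrite mxE [X in _ + X]mxE Rv.
  rewrite big_split /= Hc sumrN.
  have -> : \sum_j (ones *m v^T) i j = (v^T *m ones) 0 0.
    rewrite mxE; apply: eq_bigr => j _.
    by rewrite !mxE big_ord1 !mxE mulrC.
  by rewrite v0 mxE subr0.
under eq_bigr => j _ do rewrite mxE [X in _ + X]mxE RpartE tot.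
rewrite big_split /= sumrN sumr_const card_ord -mulr_natl.
field.
exact: nN0.
Qed.

Lemma DSpart_unique A D V : (0 < n)%N -> DSspan D -> Rspace V ->
  A = D + V -> D = DSpart A /\ V = Rpart A.
Proof.
move=> n0 /DSspan_sums[c [Hr Hc]] [v [v0 ->]] ->.
have nN0 : n%:R != 0 :> R by rewrite pnatr_eq0 -lt0n.
suff E : ones *m v^T = Rpart (D + ones *m v^T) by rewrite /DSpart -E addrK.
set V' := ones *m v^T.
have VE k l : V' k l = v l 0 by rewrite !mxE big_ord1 !mxE mul1r.
have sv : \sum_l v l 0 = 0.
  have := congr1 (fun M : 'M_1 => M 0 0) v0; rewrite mxE [in RHS]mxE => v0E.
  by rewrite -[RHS]v0E; apply: eq_bigr => l _; rewrite !mxE mulr1.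
apply/matrixP => i j; rewrite RpartE VE.
have -> : \sum_k (D + V') k j = c + n%:R * v j 0.
  under eq_bigr do rewrite mxE VE.
  by rewrite big_split /= Hc sumr_const card_ord mulr_natl.
have -> : \sum_k \sum_l (D + V') k l = n%:R * c.
  under eq_bigr => k _.
    under eq_bigr do rewrite mxE VE.
    rewrite big_split /= Hr sv addr0; over.
  by rewrite sumr_const card_ord mulr_natl.
field.
exact: nN0.
Qed.

End StochasticMatrices.

(* Main.v *)
Require Import Defs.
From mathcomp Require Import all_boot all_order all_algebra.
From mathcomp Require Import finmap multiset complex.
From mathcomp Require Import boolp classical_sets functions reals.

Import Order.TTheory GRing.Theory Num.Theory.

Local Open Scope classical_set_scope.
Local Open Scope ring_scope.

(** Write [e] for the all-ones column.  A matrix of the span of the doubly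
    stochastic matrices fixes [e] up to a scalar, and an element of [Rspace] is
    [e v^T] with [v^T e = 0].  Hence [Rspace] absorbs products with itself and
    with the doubly stochastic span, on both sides, and replacing every factor
    of a product by its doubly stochastic part changes the product by an
    element of [Rspace] only ([DS_lift_prod]).  Such a change is invisible to
    the characteristic polynomial: if [A e = c e] and [v^T e = 0] then
    [A + e v^T] and [A] have the same one ([char_poly_add_rank1]).  So spectrum
    and trace of a product in the row stochastic span see only the doubly
    stochastic parts of the factors ([DS_lift_same_invariant]).  This gives the
    transfer of preservers in both directions.

    The factorisation for at least two maps says that the doubly stochastic
    part [psi i A] of the image depends only on [DSpart A].  Put a variable
    matrix [B] in a second slot and the identity in all the others; after a
    cyclic rotation, preservation of the trace reads
    [tr (psi i A * g B) = tr (DSpart A * B)], where [g B] stays in the doubly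
    stochastic span [V].  The trace form is nondegenerate on [V], as [V] is
    closed under transposition, so the identity for [A] in [V] makes two Gram
    matrices invertible and the values [g B] span [V].  The difference
    [psi i A - psi i (DSpart A)] is orthogonal to all of them, hence zero
    ([mxtrace_preserver_span], [preserver_DSpart_factor]). *)

(** * Characteristic polynomials under rank-one perturbations *)

(** Let [B] be the bordered matrix [[M, e; v^T, 1]].  Clearing its last row by
    column operations with the corner [1] leaves the Schur complement
    [M - e v^T], so [\det B = \det (M - e v^T)].  Replacing its last column by
    [t] times itself minus the first columns weighted by [e] gives the column
    [(t e - M e, t - v^T e) = (0, t)], so [t * \det B = t * \det M]. *)
Lemma det_sub_rank1 {F : idomainType} {n : nat} (M : 'M[F]_n)
    (e v : 'cV[F]_n) (t : F) :
  t != 0 -> M *m e = t *: e -> v^T *m e = 0 -> \det (M - e *m v^T) = \det M.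
Proof.
move=> t0 Me ve.
pose B : 'M_(n + 1) := block_mx M e v^T 1%:M.
have detB : \det B = \det (M - e *m v^T).
  have : B *m block_mx 1%:M 0 (- v^T) 1%:M = block_mx (M - e *m v^T) e 0 1%:M.
    by rewrite mulmx_block !mulmx1 !mulmx0 !mul1mx !add0r mulmxN addrN.
  move=> /(congr1 determinant).
  by rewrite det_mulmx det_lblock det_ublock !det1 !mulr1.
have : B *m block_mx 1%:M (- e) 0 t%:M = block_mx M 0 v^T t%:M.
  rewrite mulmx_block !mulmx1 !mulmx0 !addr0 mul1mx !mulmxN Me ve oppr0 add0r.
  by rewrite mul_mx_scalar addNr.
move=> /(congr1 determinant).
rewrite det_mulmx det_lblock det_ublock !det1 !mul1r det_scalar1 detB.
exact: (mulIf t0).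
Qed.

Lemma char_poly_add_rank1 {F : idomainType} {n : nat} (A : 'M[F]_n)
    (e v : 'cV[F]_n) (c : F) :
  A *m e = c *: e -> v^T *m e = 0 -> char_poly (A + e *m v^T) = char_poly A.
Proof.
move=> Ae ve.
rewrite /char_poly /char_poly_mx map_mxD map_mxM -map_trmx opprD addrA.
apply: (det_sub_rank1 _ _ _ ('X - c%:P)).
- by rewrite polyXsubC_eq0.
- by rewrite mulmxBl mul_scalar_mx -map_mxM Ae map_mxZ scalerBl.
- by rewrite map_trmx -map_mxM ve map_mx0.
Qed.

(** * Spectrum and trace are functions of the characteristic polynomial *)

Lemma char_poly_spec {R : realType} {n : nat} (A B : 'M[R]_n) :
  char_poly A = char_poly B -> spec A = spec B.
Proof. by move=> AB; rewrite /spec -!map_char_poly AB. Qed.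

(** A monic polynomial over an algebraically closed field is the product of its
    linear factors, and the embedding of the reals into the complex numbers is
    injective on polynomials. *)
Lemma spec_char_poly {R : realType} {n : nat} (A B : 'M[R]_n) :
  spec A = spec B -> char_poly A = char_poly B.
Proof.
move=> /eq_seq_msetP; rewrite -!map_char_poly.
case: closed_field_poly_normal => r /= Ar.
case: closed_field_poly_normal => s /= Bs rs.
apply: (@map_poly_inj _ _ (real_complex R)).
rewrite Ar Bs !lead_coef_map !(monicP (char_poly_monic _)).
by rewrite (perm_big _ rs).
Qed.

Lemma char_poly_same_invariant {R : realType} {n : nat} (k : matrix_invariant)
    (A B : 'M[R]_n) :
  (0 < n)%N -> char_poly A = char_poly B -> same_invariant k A B.
Proof.
move=> n0 AB; case: k => /=; first exact: char_poly_spec.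
by apply: oppr_inj; rewrite -!char_poly_trace // AB.
Qed.

Lemma same_invariant_mxtrace {R : realType} {n : nat} (k : matrix_invariant)
    (A B : 'M[R]_n) :
  (0 < n)%N -> same_invariant k A B -> \tr A = \tr B.
Proof.
move=> n0; case: k => [AB|//].
exact: (char_poly_same_invariant Trace) n0 (spec_char_poly _ _ AB).
Qed.

Lemma same_invariant_sym {R : realType} {n : nat} (k : matrix_invariant)
    (A B : 'M[R]_n) : same_invariant k A B -> same_invariant k B A.
Proof. by case: k => /= ->. Qed.

Lemma same_invariant_trans {R : realType} {n : nat} (k : matrix_invariant)
    (A B C : 'M[R]_n) :
  same_invariant k A B -> same_invariant k B C -> same_invariant k A C.
Proof. by case: k => /= -> ->. Qed.

(** * The span of the doubly stochastic matrices is a commutant *)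

(** The entries of [A J] are row sums of [A] and those of [J A] are column sums,
    for [J] the all-ones matrix; they agree everywhere exactly when all these
    sums are one constant.  As a commutant, the span is visibly a subalgebra
    closed under transposition, and the kernel of a linear map. *)
Lemma DSspan_commP {R : realType} {n : nat} (A : 'M[R]_n) : (0 < n)%N ->
  DSspan A <-> A *m const_mx 1 = const_mx 1 *m A :> 'M_n.
Proof.
move=> n0.
have mulJ i j : (A *m const_mx 1 : 'M_n) i j = \sum_l A i l.
  by rewrite mxE; apply: eq_bigr => l _; rewrite mxE mulr1.
have Jmul i j : (const_mx 1 *m A : 'M_n) i j = \sum_l A l j.
  by rewrite mxE; apply: eq_bigr => l _; rewrite mxE mul1r.
split=> [/DSspan_sums[c [Ar Ac]]|AJ].
  by apply/matrixP => i j; rewrite mulJ Jmul Ar Ac.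
have rc i j : \sum_l A i l = \sum_l A l j by rewrite -(mulJ i j) AJ Jmul.
pose i0 := Ordinal n0.
apply: (@sums_DSspan _ _ _ (\sum_l A i0 l) n0) => [i|j]; last by rewrite (rc i0 j).
by rewrite (rc i i0) (rc i0 i0).
Qed.

Lemma DSspan1 {R : realType} {n : nat} : (0 < n)%N -> @DSspan R n 1.
Proof. by move=> n0; apply/DSspan_commP; rewrite // mulmx1 mul1mx. Qed.

Lemma DSspanM {R : realType} {n : nat} (A B : 'M[R]_n) : (0 < n)%N ->
  DSspan A -> DSspan B -> DSspan (A * B).
Proof.
move=> n0 /(DSspan_commP _ n0) A_J /(DSspan_commP _ n0) B_J.
by apply/DSspan_commP => //; rewrite -mulmxE -mulmxA B_J mulmxA A_J -mulmxA.
Qed.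

Lemma DSspanB {R : realType} {n : nat} (A B : 'M[R]_n) : (0 < n)%N ->
  DSspan A -> DSspan B -> DSspan (A - B).
Proof.
move=> n0 /(DSspan_commP _ n0) A_J /(DSspan_commP _ n0) B_J.
by apply/DSspan_commP => //; rewrite mulmxBl mulmxBr A_J B_J.
Qed.

Lemma DSspan_tr {R : realType} {n : nat} (A : 'M[R]_n) : (0 < n)%N ->
  DSspan A -> DSspan A^T.
Proof.
move=> n0 /(DSspan_commP _ n0) A_J; apply/DSspan_commP => //.
by apply: trmx_inj; rewrite !trmx_mul trmxK trmx_const A_J.
Qed.

Lemma DSspan_mul_ones {R : realType} {n : nat} (A : 'M[R]_n) :
  DSspan A -> exists c, A *m ones R n = c *: ones R n.
Proof.
case/DSspan_sums => c [Ar _]; exists c; apply/matrixP => i j.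
rewrite !mxE mulr1 -(Ar i).
by apply: eq_bigr => l _; rewrite mxE mulr1.
Qed.

Lemma DSspan_vspace {R : realType} {n : nat} : (0 < n)%N ->
  exists V : {vspace 'M[R]_n}, forall A, A \in V <-> DSspan A.
Proof.
move=> n0.
pose J : 'M[R]_n := const_mx 1.
exists (lker (linfun (mulmxr J) - linfun (mulmx J))%VF) => A.
rewrite memv_ker add_lfunE opp_lfunE !lfunE /= subr_eq0.
split=> [/eqP AJ|/(DSspan_commP _ n0) AJ]; last exact/eqP.
exact/(DSspan_commP _ n0).
Qed.

(** * The complement [Rspace] behaves like an ideal *)

Lemma Rspace0 {R : realType} {n : nat} : @Rspace R n 0.
Proof. by exists 0; rewrite trmx0 mul0mx mulmx0. Qed.

Lemma RspaceD {R : realType} {n : nat} (A B : 'M[R]_n) :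
  Rspace A -> Rspace B -> Rspace (A + B).
Proof.
move=> [v [v0 ->]] [w [w0 ->]]; exists (v + w).
by rewrite linearD /= mulmxDl v0 w0 addr0 mulmxDr.
Qed.

Lemma RspaceM {R : realType} {n : nat} (A B : 'M[R]_n) :
  Rspace A -> Rspace B -> Rspace (A * B).
Proof.
move=> [v [v0 ->]] [w [_ ->]].
by rewrite -mulmxE -mulmxA (mulmxA v^T) v0 mul0mx mulmx0; exact: Rspace0.
Qed.

Lemma Rspace_mulr {R : realType} {n : nat} (V D : 'M[R]_n) :
  Rspace V -> DSspan D -> Rspace (V * D).
Proof.
move=> [v [v0 ->]] /DSspan_mul_ones[c Dc]; exists (D^T *m v).
rewrite trmx_mul trmxK -mulmxA Dc -scalemxAr v0 scaler0; split=> //.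
by rewrite -mulmxE mulmxA.
Qed.

Lemma Rspace_mull {R : realType} {n : nat} (V D : 'M[R]_n) :
  Rspace V -> DSspan D -> Rspace (D * V).
Proof.
move=> [v [v0 ->]] /DSspan_mul_ones[c Dc]; exists (c *: v).
rewrite linearZ /= -scalemxAl v0 scaler0; split=> //.
by rewrite -mulmxE mulmxA Dc -scalemxAl scalemxAr.
Qed.

(** [e v^T] is the combination, with coefficients [v_j], of the row stochastic
    matrices whose column [j] is all ones and whose other columns vanish. *)
Lemma Rspace_RSspan {R : realType} {n : nat} (V : 'M[R]_n) :
  Rspace V -> RSspan V.
Proof.
case=> v [_ ->].
exists n, (fun j => v j 0), (fun j => \matrix_(_, l) (l == j)%:R); split.
  move=> j; split=> [i l|i]; first by rewrite mxE ler0n.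
  rewrite (bigD1 j) //= mxE eqxx big1 ?addr0 // => l /negPf lj.
  by rewrite mxE lj.
apply/matrixP => i j; rewrite mxE big_ord1 !mxE mul1r summxE (bigD1 j) //=.
rewrite !mxE eqxx mulr1 big1 ?addr0 // => l /negPf lj.
by rewrite !mxE eq_sym lj mulr0.
Qed.

Lemma linear_spanD {R : realType} {n : nat} (S : set 'M[R]_n) A B :
  linear_span S A -> linear_span S B -> linear_span S (A + B).
Proof.
move=> [p [a [M [SM ->]]]] [q [b [N [SN ->]]]].
exists (p + q)%N,
  (fun i => match fintype.split i with inl j => a j | inr j => b j end),
  (fun i => match fintype.split i with inl j => M j | inr j => N j end).
split=> [i|]; first by case: fintype.split.
rewrite big_split_ord /=; congr (_ + _); apply: eq_bigr => i _.
  by rewrite (unsplitK (inl i)).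
by rewrite (unsplitK (inr i)).
Qed.

(** * Congruence modulo [Rspace] *)

(** Taking the doubly stochastic part, stated as a relation: it is then
    multiplicative by expanding one product, where [DSpart] itself would need
    the uniqueness of the decomposition at every step. *)
Definition DS_lift {R : realType} {n : nat} (A D : 'M[R]_n) : Prop :=
  DSspan D /\ Rspace (A - D).

Lemma DS_liftD {R : realType} {n : nat} (D V : 'M[R]_n) :
  DSspan D -> Rspace V -> DS_lift (D + V) D.
Proof. by move=> DD RV; split; rewrite // addrAC subrr add0r. Qed.

Lemma DS_lift_DSpart {R : realType} {n : nat} (A : 'M[R]_n) : (0 < n)%N ->
  RSspan A -> DS_lift A (DSpart A).
Proof.
move=> n0 RA; split; first exact: DSpart_DSspan.
by rewrite /DSpart subKr; exact: Rpart_Rspace.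
Qed.

Lemma DS_lift_RSspan {R : realType} {n : nat} (A D : 'M[R]_n) :
  DS_lift A D -> RSspan A.
Proof.
case=> DD RV; rewrite -(subrK D A); apply: linear_spanD.
  exact: Rspace_RSspan.
exact: DSspan_RSspan.
Qed.

(** With [A_i = D_i + V_i], expanding gives
    [A_1 A_2 - D_1 D_2 = V_1 D_2 + V_1 V_2 + D_1 V_2]. *)
Lemma DS_lift_prod {R : realType} {n : nat} (I : Type) (r : seq I)
    (A D : I -> 'M[R]_n) : (0 < n)%N ->
  (forall i, DS_lift (A i) (D i)) ->
  DS_lift (\prod_(i <- r) A i) (\prod_(i <- r) D i).
Proof.
move=> n0 AD; apply: (big_ind2 (@DS_lift R n)) => //.
  by split; [exact: DSspan1 | rewrite subrr; exact: Rspace0].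
move=> A1 D1 A2 D2 [DD1 RV1] [DD2 RV2]; split; first exact: DSspanM.
set V1 := A1 - D1 in RV1; set V2 := A2 - D2 in RV2.
have -> : A1 * A2 - D1 * D2 = V1 * D2 + V1 * V2 + D1 * V2.
  by rewrite -mulrDr (addrC D2) subrK mulrBl mulrBr addrA subrK.
by apply: RspaceD; [apply: RspaceD|];
  [apply: Rspace_mulr | apply: RspaceM | apply: Rspace_mull].
Qed.

Lemma DS_lift_same_invariant {R : realType} {n : nat} (k : matrix_invariant)
    (A D : 'M[R]_n) : (0 < n)%N -> DS_lift A D -> same_invariant k A D.
Proof.
move=> n0 [DD [v [v0 AD]]]; apply: char_poly_same_invariant => //.
have [c Dc] := DSspan_mul_ones _ DD.
by rewrite -(subrK D A) addrC AD (char_poly_add_rank1 _ _ _ _ Dc).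
Qed.

Lemma DSpart_id {R : realType} {n : nat} (A : 'M[R]_n) : (0 < n)%N ->
  DSspan A -> DSpart A = A.
Proof.
move=> n0 DA; apply/esym.
by have [] := DSpart_unique n0 DA Rspace0 (esym (addr0 A)).
Qed.

(** * Maps adjoint for a nondegenerate form *)

Section TraceForm.
Variables (F : fieldType) (n : nat) (V : {vspace 'M[F]_n}).
Implicit Types A B X : 'M[F]_n.

(* [T] is the Gram matrix of the trace form in the basis [b], and [co A] the
   coordinate row of [A]. *)
Let b := vbasis V.
Let co A : 'rV[F]_(\dim V) := \row_k coord b k A.
Let T : 'M[F]_(\dim V) := \matrix_(k, l) \tr (b`_k *m b`_l).

Let mxtrace_coord A B : A \in V -> B \in V ->
  \tr (A *m B) = (co A *m T *m (co B)^T) 0 0.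
Proof.
move=> VA VB; rewrite {1}(coord_vbasis VA) {1}(coord_vbasis VB).
rewrite mulmx_sumr linear_sum mxE; apply: eq_bigr => l _ /=.
rewrite mulmx_suml linear_sum !mxE mulr_suml; apply: eq_bigr => k _.
by rewrite -scalemxAl -scalemxAr !linearZ /= !mxE mulrA mulrAC.
Qed.

Let co_eq0 A : A \in V -> co A = 0 -> A = 0.
Proof.
move=> VA A0; rewrite (coord_vbasis VA) big1 // => k _.
by move/rowP: A0 => /(_ k); rewrite !mxE => ->; rewrite scale0r.
Qed.

(** Evaluating the identity on a basis gives [F T G^T = T] for the coordinate
    matrices [F], [G] of the images under [f] and [g].  Since [T] is invertible
    by nondegeneracy, so is [G]: the images under [g] span [V], even though
    neither [f] nor [g] is supposed linear. *)
Lemma mxtrace_preserver_span (f g : 'M[F]_n -> 'M[F]_n) X :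
  (forall A, A \in V -> (forall B, B \in V -> \tr (A *m B) = 0) -> A = 0) ->
  (forall A, A \in V -> f A \in V) -> (forall B, B \in V -> g B \in V) ->
  (forall A B, A \in V -> B \in V -> \tr (f A *m g B) = \tr (A *m B)) ->
  X \in V -> (forall B, B \in V -> \tr (X *m g B) = 0) -> X = 0.
Proof.
move=> nondeg Vf Vg fg VX Xg.
have Vb (k : 'I_(\dim V)) : b`_k \in V by rewrite vbasis_mem // memt_nth.
pose Fm := \matrix_(k < \dim V) co (f b`_k).
pose Gm := \matrix_(k < \dim V) co (g b`_k).
have FTG : Fm *m T *m Gm^T = T.
  apply/matrixP => k l; rewrite [RHS]mxE -fg // mxtrace_coord ?Vf ?Vg //.
  rewrite -[co (f _)](rowK (fun k : 'I__ => co (f b`_k)) k).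
  rewrite -[co (g _)](rowK (fun k : 'I__ => co (g b`_k)) l).
  by rewrite -!row_mul -/Fm -/Gm !mxE; apply: eq_bigr => j _; rewrite !mxE.
have Tunit : T \in unitmx.
  rewrite -row_free_unit; apply: inj_row_free => x xT.
  pose Y := \sum_k x 0 k *: b`_k.
  have VY : Y \in V by apply: memv_suml => k _; apply: memvZ.
  have coY : co Y = x.
    by apply/rowP => k; rewrite mxE coord_sum_free // (basis_free (vbasisP V)).
  (* A left kernel vector of [T] is an element of [V] orthogonal to [V]. *)
  rewrite -coY (nondeg Y) //; first by apply/rowP => k; rewrite !mxE linear0.
  by move=> B VB; rewrite mxtrace_coord // coY xT mul0mx mxE.
have Gunit : Gm^T \in unitmx by move: Tunit; rewrite -{1}FTG unitmx_mul => /andP[].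
apply: co_eq0 => //; apply: (can_inj (mulmxK Tunit)); rewrite mul0mx.
apply: (can_inj (mulmxK Gunit)); rewrite mul0mx.
apply/rowP => l; rewrite [RHS]mxE -[RHS](Xg b`_l) // mxtrace_coord ?Vg //.
by rewrite !mxE; apply: eq_bigr => j _; rewrite !mxE.
Qed.

End TraceForm.

Lemma mxtrace_mul_tr_eq0 {F : realFieldType} {n : nat} (A : 'M[F]_n) :
  \tr (A *m A^T) = 0 -> A = 0.
Proof.
have sq i : 0 <= (A *m A^T) i i.
  by rewrite mxE sumr_ge0 // => j _; rewrite mxE sqr_ge0.
move=> /eqP; rewrite psumr_eq0 // => /allP /= tr0.
apply/matrixP => i j; rewrite mxE.
have := tr0 i (mem_index_enum i); rewrite mxE psumr_eq0; last first.
  by move=> l _; rewrite mxE sqr_ge0.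
by move=> /allP /(_ j (mem_index_enum j)); rewrite mxE mulf_eq0 orbb => /eqP.
Qed.

(** * Rotating a product under the trace *)

Lemma mxtrace_prod_rot {R : comPzRingType} {m n : nat} (i : 'I_m) :
  exists s : seq 'I_m, [/\ uniq (i :: s), size (i :: s) = m &
    forall F : 'I_m -> 'M[R]_n,
      \tr (\prod_(j < m) F j) = \tr (F i * \prod_(j <- s) F j)].
Proof.
have enumE : exists s1 s2, index_enum 'I_m = s1 ++ i :: s2.
  by case: (splitPr (mem_index_enum i)) => s1 s2; exists s1, s2.
case: enumE => s1 [s2 E].
have rot : perm_eq (i :: s2 ++ s1) (index_enum 'I_m).
  by rewrite E -cat_cons perm_catC.
exists (s2 ++ s1); split.
- by rewrite (perm_uniq rot) index_enum_uniq.
- by rewrite (perm_size rot) -[RHS]card_ord cardE enumT.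
move=> F; rewrite E !big_cat big_cons /= -!mulmxE.
by rewrite mxtrace_mulC -!mulmxA.
Qed.

(** * Preservers *)

(** Only two slots matter: the [i]-th one and another slot [j] that carries the
    test matrix.  All the remaining factors are evaluated at [1], and the fixed
    product of their images is absorbed into the second map [g]. *)
Lemma preserver_DSpart_factor {R : realType} {m n : nat}
    (psi : 'I_m -> 'M[R]_n -> 'M[R]_n) (i : 'I_m) (A : 'M[R]_n) :
  (0 < n)%N -> (2 <= m)%N ->
  (forall j B, RSspan B -> DSspan (psi j B)) ->
  (forall B : 'I_m -> 'M[R]_n, (forall j, RSspan (B j)) ->
     \tr (\prod_(j < m) psi j (B j)) = \tr (\prod_(j < m) DSpart (B j))) ->
  RSspan A -> psi i A = psi i (DSpart A).
Proof.
move=> n0 m2 Dpsi trpsi RA.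
have [[|j s] [/= us ms rot]] := @mxtrace_prod_rot R m n i.
  by move: m2; rewrite -ms.
have [/negP ij js] : ~ (i \in j :: s) /\ j \notin s by case/and3P: us => /negP.
have R1 : @RSspan R n 1 by apply: DSspan_RSspan; exact: DSspan1.
pose g B := psi j B * \prod_(l <- s) psi l 1.
have fg B C : RSspan B -> DSspan C -> \tr (psi i B *m g C) = \tr (DSpart B *m C).
  move=> RB DC.
  pose X l := if l == i then B else if l == j then C else 1.
  have Xi : X i = B by rewrite /X eqxx.
  have ji : (j == i) = false.
    by apply: contraNF ij => /eqP ->; rewrite mem_head.
  have Xj : X j = C by rewrite /X ji eqxx.
  have Xs l : l \in s -> X l = 1.
    move=> ls; rewrite /X; case: eqP => [li|_].
      by move: ij; rewrite -li inE ls orbT.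
    by case: eqP => // lj; move: js; rewrite -lj ls.
  have RX l : RSspan (X l).
    by rewrite /X; do 2?case: ifP => // _; exact: DSspan_RSspan.
  have tail_psi : \prod_(l <- s) psi l (X l) = \prod_(l <- s) psi l 1.
    by apply: eq_big_seq => l ls; rewrite Xs.
  have tail1 : \prod_(l <- s) DSpart (X l) = 1.
    rewrite big_seq big1 // => l ls; rewrite Xs // DSpart_id //.
    exact: DSspan1.
  have := trpsi X RX.
  by rewrite !rot !big_cons Xi Xj tail_psi tail1 mulr1 (DSpart_id C).
have [V DV] := @DSspan_vspace R n n0.
have DS_RS := @DSspan_RSspan R n.
apply/eqP; rewrite -subr_eq0; apply/eqP.
apply: (mxtrace_preserver_span _ _ V (psi i) g).
- move=> B /DV DB nondeg; apply: mxtrace_mul_tr_eq0; apply: nondeg.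
  exact/DV/DSspan_tr.
- by move=> B /DV DB; apply/DV/Dpsi/DS_RS.
- move=> B /DV DB; apply/DV/DSspanM => //; first exact/Dpsi/DS_RS.
  by apply: big_ind => [|C D|l _]; [exact: DSspan1 | exact: DSspanM | exact: Dpsi].
- by move=> B C /DV DB /DV DC; rewrite fg ?DSpart_id //; exact: DS_RS.
- by apply/DV/DSspanB => //; apply: Dpsi => //; apply/DS_RS/DSpart_DSspan.
- move=> B /DV DB; have DA := DSpart_DSspan n0 RA.
  rewrite mulmxBl linearB /= !fg //; last exact: DS_RS.
  by rewrite (DSpart_id (DSpart A)) // subrr.
Qed.

Theorem theorem2p6 (R : realType) (m n : nat) (hm : (0 < m)%N) (hn : (0 < n)%N)
    (k : matrix_invariant) :
  (forall phi gamma : 'I_m -> 'M[R]_n -> 'M[R]_n,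
     multiplicative_preserver k (@DSspan R n) phi ->
     (forall i, set_fun (@RSspan R n) (@Rspace R n) (gamma i)) ->
     let phit := fun (i : 'I_m) (A : 'M[R]_n) => phi i (DSpart A) + gamma i A in
     multiplicative_preserver k (@RSspan R n) phit /\
     ((forall i, forall A, @DSspan R n A -> phit i A = phi i A) <->
      (forall i, forall A, @DSspan R n A -> gamma i A = 0)))
  /\
  (forall psit : 'I_m -> 'M[R]_n -> 'M[R]_n,
     multiplicative_preserver k (@RSspan R n) psit ->
     let psi := fun (i : 'I_m) (A : 'M[R]_n) => DSpart (psit i A) in
     let gamma := fun (i : 'I_m) (A : 'M[R]_n) => Rpart (psit i A) in
     multiplicative_preserver k (@DSspan R n) psi /\
     ((2 <= m)%N ->
      forall i, set_fun (@RSspan R n) (@Rspace R n) (gamma i) /\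
        (forall A, @RSspan R n A -> psit i A = psi i (DSpart A) + gamma i A))).
Proof.
split=> [phi gamma [phiD phiP] gammaR phit|psit [psitR psitP] psi gamma].
  have lift i A : RSspan A -> DS_lift (phit i A) (phi i (DSpart A)).
    move=> RA; apply: DS_liftD; last exact: gammaR.
    exact/phiD/DSpart_DSspan.
  split; last first.
    split=> E i A DA; have := E i A DA; rewrite /phit DSpart_id //.
      by move=> /eqP; rewrite addrC -subr_eq0 addrK => /eqP.
    by move=> ->; rewrite addr0.
  split=> [i A RA|A RA]; first exact: DS_lift_RSspan (lift i A RA).
  apply: same_invariant_trans.
    apply: DS_lift_same_invariant => //; apply: DS_lift_prod => // i.
    exact/lift/RA.
  apply: same_invariant_trans.
    by apply: phiP => i; apply: DSpart_DSspan.
  apply/same_invariant_sym/DS_lift_same_invariant/DS_lift_prod => // i.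
  exact: DS_lift_DSpart.
have lift i A : RSspan A -> DS_lift (psit i A) (psi i A).
  by move=> RA; apply: DS_lift_DSpart => //; exact: psitR.
have psiP (A : 'I_m -> 'M[R]_n) : (forall i, RSspan (A i)) ->
    same_invariant k (\prod_(i < m) psi i (A i)) (\prod_(i < m) A i).
  move=> RA; apply: same_invariant_trans (psitP A RA).
  apply/same_invariant_sym/DS_lift_same_invariant/DS_lift_prod => // i.
  exact/lift/RA.
split.
  split=> [i A /DSspan_RSspan RA|A DA]; first by have [] := lift i A RA.
  by apply: psiP => i; apply: DSspan_RSspan.
move=> m2 i; split=> [A _|A RA]; first exact: Rpart_Rspace.
rewrite -(preserver_DSpart_factor psi) // ?/psi ?/DSpart ?subrK //.
  by move=> j B RB; have [] := lift j B RB.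
move=> B RB; apply: (same_invariant_mxtrace k) => //.
apply: same_invariant_trans (psiP B RB) _.
apply: DS_lift_same_invariant => //; apply: DS_lift_prod => // j.
exact: DS_lift_DSpart.
Qed.
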